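(* Let $\kappa$ be an infinite cardinal and $X$ a $\kappa$wH-closed Hausdorff space with a dense set of isolated points and $\chi(X)\leq\kappa$. Then $|X|\leq 2^\kappa$.
   Context: $\chi(X)$ denotes the character of $X$. For $A\subseteq X$, $cl_\theta(A)=\{x\in X: cl(U)\cap A\neq\varnothing\text{ for every open }U\ni x\}$. For a filter base $\mathcal F$ on $X$, $a_\theta\mathcal F=\bigcap\{cl_\theta(F):F\in\mathcal F\}$. A filter base $\mathcal F$ on $X$ is $\kappa$-wide if $|cl_\theta(A)|\geq\kappa$ for each $A\in\mathcal F$. $X$ is $\kappa$wH-closed if $a_\theta\mathcal F\neq\varnothing$ for each $\kappa$-wide filter base $\mathcal F$ on $X$. *)

(* Defs.v *)
From mathcomp Require Import all_boot all_order all_algebra.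
From mathcomp Require Import all_classical topology.

Set Implicit Arguments.
Unset Strict Implicit.
Unset Printing Implicit Defensive.

Local Open Scope classical_set_scope.
Local Open Scope card_scope.

(* A cardinal kappa is represented by a type K with |K| = kappa: kappa is
   infinite when [infinite_set [set: K]] holds, cardinals are compared with
   [#<=] (existence of an injection), and 2^kappa is the cardinality of the
   powerset [set K]. *)

Section Spaces.
Context {X : topologicalType}.

Definition local_base (x : X) (B : set (set X)) :=
  B `<=` open_nbhs x /\
  forall U, open_nbhs x U -> exists2 V, B V & V `<=` U.

Definition theta_closure (A : set X) : set X :=
  [set x | forall U, open_nbhs x U -> closure U `&` A !=set0].

Definition filter_base (F : set (set X)) :=
  [/\ F !=set0,
      forall A, F A -> A !=set0 &
      forall A B, F A -> F B -> exists2 C, F C & C `<=` A `&` B].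

Definition theta_adherence (F : set (set X)) : set X :=
  \bigcap_(A in F) theta_closure A.

Definition wide (K : Type) (F : set (set X)) :=
  forall A, F A -> [set: K] #<= theta_closure A.

End Spaces.

(* chi(X) <= |K|. The character chi(X) is the supremum over x of the least
   cardinality of a local base at x; it is bounded by |K| exactly when every
   point has a local base of cardinality at most |K|. (Conventions making
   chi(X) infinite by definition do not matter when K is infinite.) *)
Definition character_le (X : topologicalType) (K : Type) :=
  forall x : X, exists2 B, local_base x B & B #<= [set: K].

Definition wH_closed (K : Type) (X : topologicalType) :=
  forall F : set (set X),
    filter_base F -> wide K F -> theta_adherence F !=set0.

(* Main.v *)
(** Let [D] be the set of isolated points, and fix at each point a local base
    indexed by [K].  A closing-off argument gives a set [S] of at most 2^|K|
    points of [D] such that, for each finite family of basic neighbourhoods of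
    points of the closure of [S], the set of points of [D] missed by the family
    either lies in [S] or meets [S] in at least |K| points.  Then [S = D]: if
    [d] were in [D] but not in [S], choose for each point of the closure of [S]
    a basic neighbourhood avoiding [d], and the complement of the closure of [S]
    for every other point.  As traces of open sets on [D] coincide with the
    traces of their closures, these neighbourhoods leave the filter base of the
    sets of points of [S] missed by finitely many of them without theta-adherent
    points, so one of these sets has fewer than |K| points; but the
    corresponding subset of [D] contains [d], hence is not included in [S].
    Finally X is the closure of [D], and a Hausdorff space of character at most
    |K| has at most |D|^|K| points in the closure of [D]. *)
Require Import Defs.
From mathcomp Require Import all_boot all_order all_algebra.
From mathcomp Require Import all_classical topology.

Set Implicit Arguments.
Unset Strict Implicit.
Unset Printing Implicit Defensive.

Local Open Scope classical_set_scope.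
Local Open Scope card_scope.

(** * Comparison of cardinals by injections *)

Definition embeds (T U : Type) := exists f : T -> U, injective f.

Lemma embeds_refl (T : Type) : embeds T T.
Proof. by exists id. Qed.

Lemma card_le_rel {T U : Type} (A : set T) (B : set U) (R : T -> U -> Prop) :
    (forall a, A a -> exists2 b, B b & R a b) ->
    (forall a a' b, A a -> A a' -> R a b -> R a' b -> a = a') ->
  A #<= B.
Proof.
elim/Ppointed: U => U in B R *.
  move=> AB _; rewrite (_ : A = set0) ?card_ge0//.
  by rewrite -subset0 => a /AB[b]; case: (no b).
move=> AB Rinj.
have /choice[f fP] a : exists b, A a -> B b /\ R a b.
  have [Aa|nAa] := pselect (A a); last by exists point.
  by have [b] := AB _ Aa; exists b.
apply/pcard_leP/injfunPex; exists f => [a /fP[]//|a a' /set_mem Aa /set_mem Aa' E].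
apply: (Rinj _ _ (f a)) => //; first exact: (fP _ Aa).2.
by rewrite E; exact: (fP _ Aa').2.
Qed.

Lemma card_le_inj {T U : Type} (u0 : U) (A : set T) (B : set U) :
  A #<= B -> exists2 f : T -> U, forall a, A a -> B (f a) &
    forall a a', A a -> A a' -> f a = f a' -> a = a'.
Proof.
elim/Ppointed: U u0 => U u0 in B *; first by case: (no u0).
move=> /pcard_leP/injfunPex[f fAB finj]; exists f => // a a' Aa Aa'.
by apply: finj; exact: mem_set.
Qed.

Lemma card_le_embeds (T U : Type) : [set: T] #<= [set: U] -> embeds T U.
Proof.
move=> TU; have [[u0 _]|U0] := pselect (exists u : U, True).
  by have [f _ finj] := card_le_inj u0 TU; exists f => a b; exact: finj.
have T0 : T -> False.
  move=> t; apply: U0; have /card_leP[f] := TU.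
  by exists (set_val (f (to_setT t))).
by exists (fun t => match T0 t with end) => t; case: (T0 t).
Qed.

Lemma embeds_card_le (T U : Type) (B : set U) (f : T -> U) :
  (forall t, B (f t)) -> injective f -> [set: T] #<= B.
Proof.
move=> fB finj; apply: (card_le_rel (R := fun t u => f t = u)) => [t _|t t' _ _ _ <-].
  by exists (f t).
by move=> /finj.
Qed.

(** A maximal partial injection from [A] to [B], given by Zorn's lemma, is total on [A] or onto [B];
    otherwise one more pair could be added to its graph. *)
Lemma card_le_total {T U : Type} (A : set T) (B : set U) : A #<= B \/ B #<= A.
Proof.
pose P (G : set (T * U)) := [/\ forall p, G p -> A p.1 /\ B p.2,
  forall t u u', G (t, u) -> G (t, u') -> u = u' &
  forall t t' u, G (t, u) -> G (t', u) -> t = t'].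
have [|G [[GAB Gfun Ginj] Gmax]] := @Zorn_bigcup _ P.
  move=> F FP Ftot.
  have two p q : (\bigcup_(X in F) X) p -> (\bigcup_(X in F) X) q ->
      exists X, [/\ F X, X p & X q].
    move=> [X FX Xp] [Y FY Yq]; have [XY|YX] := Ftot _ _ FX FY.
      by exists Y; split => //; exact: XY.
    by exists X; split => //; exact: YX.
  split.
  - by move=> p [X /FP[+ _ _] Xp]; exact.
  - by move=> t u u' p q; have [X [/FP[_ + _]]] := two _ _ p q; exact.
  - by move=> t t' u p q; have [X [/FP[_ _ +]]] := two _ _ p q; exact.
have [AG|/existsNP[a /not_implyP[Aa nGa]]] :=
    pselect (forall a, A a -> exists2 b, B b & G (a, b)).
  by left; apply: (card_le_rel (R := fun a b => G (a, b))) => // a a' b _ _; exact: Ginj.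
have [BG|/existsNP[b /not_implyP[Bb nGb]]] :=
    pselect (forall b, B b -> exists2 a, A a & G (a, b)).
  by right; apply: (card_le_rel (R := fun b a => G (a, b))) => // u u' t _ _; exact: Gfun.
have nGa' u : ~ G (a, u) by move=> Gau; apply: nGa; exists u => //; case: (GAB _ Gau).
have nGb' t : ~ G (t, b) by move=> Gtb; apply: nGb; exists t => //; case: (GAB _ Gtb).
exfalso; apply: (Gmax (G `|` [set (a, b)])).
  by split=> [p|/(_ (a, b) (or_intror erefl))]; [left|exact: nGa'].
split.
- by move=> p [/GAB//|->].
- move=> t u u' [Gu|[-> ->]] [Gu'|] => [|[tE uE]||[->]//].
  + exact: Gfun Gu Gu'.
  + by case: (nGa' u); rewrite -tE.
  + by case: (nGa' u').
- move=> t t' u [Gu|[-> ->]] [Gu'|] => [|[tE uE]||[->]//].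
  + exact: Ginj Gu Gu'.
  + by case: (nGb' t); rewrite -uE.
  + by case: (nGb' t').
Qed.

(** * The square of an infinite cardinal *)

Section square.
Variable K : Type.
Hypothesis K_infinite : infinite_set [set: K].

Lemma embeds_nat : embeds nat K.
Proof. by apply: card_le_embeds; apply/infiniteP. Qed.

Let square_on (p : set K * (K -> K -> K)) :=
  (forall a b, p.1 a -> p.1 b -> p.1 (p.2 a b)) /\
  (forall a b a' b', p.1 a -> p.1 b -> p.1 a' -> p.1 b' ->
     p.2 a b = p.2 a' b' -> a = a' /\ b = b').

(** [p.2 i] and [p.2 j] map [p.1] to two disjoint copies of itself inside [p.1]: one receives [p.1],
    the other receives the rest of [S] through [g]. *)
Let glue (p : set K * (K -> K -> K)) (S : set K) (g : K -> K) (i j : K) :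
  square_on p -> i <> j -> p.1 i -> p.1 j ->
  (forall x, S x -> ~ p.1 x -> p.1 (g x)) ->
  (forall x y, S x -> S y -> ~ p.1 x -> ~ p.1 y -> g x = g y -> x = y) ->
  exists2 c : K -> K, forall x, p.1 x \/ S x -> p.1 (c x) &
    forall x y, p.1 x \/ S x -> p.1 y \/ S y -> c x = c y -> x = y.
Proof.
case: p => A f [/= fA finj] ij Ai Aj gA ginj.
exists (fun x => if pselect (A x) then f i x else f j (g x)).
  by move=> x; case: pselect => /= [Ax _|nAx [//|Sx]]; apply: fA => //; exact: gA.
move=> x y; case: pselect => /= Ax; case: pselect => /= Ay.
- by move=> _ _ /finj[].
- by move=> _ [//|Sy] /finj[]//; exact: gA.
- by move=> [//|Sx] _ /finj[]//; [exact: gA|move=> /esym].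
- move=> [//|Sx] [//|Sy] /finj[]//; [exact: gA|exact: gA|move=> _].
  exact: ginj.
Qed.

(* Zorn's lemma on pairs (A, f) with f injective from A x A to A.  When A is
   maximal, its complement embeds in A, for otherwise f extends to the union of
   A and a disjoint copy of A. *)
Lemma embeds_square : embeds (K * K) K.
Proof.
have [i i_inj] := embeds_nat.
(* Keeping the range of [i] in the carrier provides the distinct points [i 0] and [i 1] that [glue]
   needs. *)
pose T := {p | square_on p /\ forall n, p.1 (i n)}.
pose R (p q : T) := `[< (sval p).1 `<=` (sval q).1 /\
  forall a b, (sval p).1 a -> (sval p).1 b -> (sval p).2 a b = (sval q).2 a b >].
pose mk p (pP : square_on p /\ forall n, p.1 (i n)) : T := exist _ p pP.
have [r ri] : exists r : K -> nat, forall n, r (i n) = n.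
  have /choice[r rP] x : exists n, forall m, i m = x -> m = n.
    have [[n <-]|nx] := pselect (exists n, i n = x).
      by exists n => m; exact: i_inj.
    by exists 0 => m mx; case: nx; exists m.
  by exists r => n; rewrite -(rP (i n) n).
have t0 : T.
  exists (range i, fun a b => i (pickle (r a, r b))).
  split=> [|n]; last by exists n.
  split=> /=; first by move=> a b _ _; exists (pickle (r a, r b)).
  move=> _ _ _ _ [a _ <-] [b _ <-] [a' _ <-] [b' _ <-].
  by rewrite !ri => /i_inj/(pcan_inj pickleK)[-> ->].
have [||C Ctot|[[A f] /= [sqA iA]] Amax] := ZL_preorder t0 (R := R).
- by move=> t; apply/asboolP; split.
- move=> p q s /asboolP[pq fpq] /asboolP[qs fqs]; apply/asboolP; split.
    by move=> x /pq/qs.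
  by move=> a b pa pb; rewrite fpq// fqs//; exact: pq.
- have [[q0 Cq0]|C0] := pselect (exists q, C q); last first.
    by exists t0 => q Cq; case: C0; exists q.
  have two p q : C p -> C q -> exists2 s, C s & R p s /\ R q s.
    move=> Cp Cq; have Rxx x : R x x by apply/asboolP; split.
    by have [pq|qp] := Ctot _ _ Cp Cq; [exists q|exists p].
  (* Members of the chain agree wherever they are defined, so [f] can take their common value. *)
  have /choice[f fP] ab : exists v, forall q, C q ->
      (sval q).1 ab.1 -> (sval q).1 ab.2 -> (sval q).2 ab.1 ab.2 = v.
    have [[p [Cp pa pb]]|nab] :=
        pselect (exists p, [/\ C p, (sval p).1 ab.1 & (sval p).1 ab.2]).
      exists ((sval p).2 ab.1 ab.2) => q Cq qa qb.
      have [s Cs [/asboolP[_ ps] /asboolP[_ qs]]] := two p q Cp Cq.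
      by rewrite ps// qs.
    by exists ab.1 => q Cq qa qb; case: nab; exists q.
  pose A := \bigcup_(q in C) (sval q).1.
  have twoA a b : A a -> A b -> exists2 q, C q & (sval q).1 a /\ (sval q).1 b.
    move=> [p Cp pa] [q Cq qb].
    have [s Cs [/asboolP[ps _] /asboolP[qs _]]] := two p q Cp Cq.
    by exists s => //; split; [exact: ps|exact: qs].
  have pA : square_on (A, fun a b => f (a, b)) /\
      forall n, (A, fun a b => f (a, b)).1 (i n).
    split=> [|n] /=; last by exists q0 => //; exact: (svalP q0).2.
    split=> /= [a b Aa Ab|a b a' b' Aa Ab Aa' Ab'].
      have [q Cq [qa qb]] := twoA _ _ Aa Ab.
      exists q => //; rewrite -(fP (a, b) q)//=.
      by case: (svalP q) => -[+ _] _; exact.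
    have [p Cp [pa pb]] := twoA _ _ Aa Ab.
    have [q Cq [qa qb]] := twoA _ _ Aa' Ab'.
    have [s Cs [/asboolP[ps _] /asboolP[qs _]]] := two p q Cp Cq.
    move: pa pb qa qb => /ps sa /ps sb /qs sa' /qs sb'.
    rewrite -(fP (a, b) s)// -(fP (a', b') s)//=.
    by case: (svalP s) => -[_ +] _; exact.
  exists (mk _ pA) => q Cq; apply/asboolP; split=> /=.
    by move=> x qx; exists q.
  by move=> a b qa qb; exact: (fP (a, b)).
have i01 : i 0 <> i 1 by move=> /i_inj.
have [fA finj] := (sqA); rewrite /= in fA finj.
(* If the complement of [A] embeds in [A], then [glue] compresses all of [K] into [A], where [f]
   encodes pairs. *)
have [|] := card_le_total (~` A) A.
  move=> /(card_le_inj (i 0))[g gA ginj].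
  have [||c cA cinj] := @glue _ (~` A) g _ _ sqA i01 (iA 0) (iA 1).
  - by move=> x Sx _; exact: gA.
  - by move=> x y Sx Sy _ _; exact: ginj.
  have AS x : A x \/ (~` A) x by exact: EM.
  exists (fun p => f (c p.1) (c p.2)) => -[a b] [a' b'] /= /finj[||||]; try exact: cA.
  by move=> /cinj -> // /cinj ->.
move=> /(card_le_inj (i 0))[h hA hinj].
have /choice[g gP] x : exists y, forall z, A z -> h z = x -> z = y.
  have [[y Ay <-]|nx] := pselect (exists2 y, A y & h y = x).
    by exists y => z Az; exact: hinj.
  by exists x => z Az zx; case: nx; exists z.
have gh y : A y -> g (h y) = y by move=> Ay; rewrite -(gP (h y) y).
have [||c cA cinj] := @glue _ (h @` A) g _ _ sqA i01 (iA 0) (iA 1).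
- by move=> _ [x Ax <-] _ /=; rewrite gh.
- by move=> _ _ [x Ax <-] [y Ay <-] _ _; rewrite !gh// => ->.
rewrite /= in cA cinj.
pose A' := A `|` h @` A.
(* Pairs not in [A] x [A] are compressed into [A] by [c], then sent by [f] and [h] to values outside
   [A], so they never collide with the old ones. *)
pose f' a b := if pselect (A a /\ A b) then f a b else h (f (c a) (c b)).
have pA' : square_on (A', f') /\ forall n, (A', f').1 (i n).
  split=> [|n]; last by left; exact: iA.
  split=> /= [a b Aa Ab|a b a' b' Aa Ab Aa' Ab']; rewrite /f'.
    case: pselect => /= [[Pa Pb]|_]; first by left; exact: fA.
    by right; exists (f (c a) (c b)) => //; apply: fA; exact: cA.
  have fc x y : A' x -> A' y -> A (f (c x) (c y)).
    by move=> Ax Ay; apply: fA; exact: cA.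
  case: pselect => /= [[Pa Pb]|_]; case: pselect => /= [[Pa' Pb']|_].
  - exact: finj.
  - by move=> E; case: (hA _ (fc _ _ Aa' Ab')); rewrite -E; exact: fA.
  - by move=> E; case: (hA _ (fc _ _ Aa Ab)); rewrite E; exact: fA.
  - move=> /hinj => /(_ (fc _ _ Aa Ab) (fc _ _ Aa' Ab')) /finj[]; try exact: cA.
    by move=> /cinj -> // /cinj ->.
have /asboolP[/= A'A _] : R (mk _ pA') (mk (A, f) (conj sqA iA)).
  apply: Amax; apply/asboolP; split=> /= [x|a b Aa Ab]; first by left.
  by rewrite /f'; case: pselect => // -[].
by case: (hA (i 0)) => //; apply: A'A; right; exists (i 0).
Qed.

End square.

(** * Arithmetic of sets of at most 2^|K| elements *)

Section covered.
Variable K : Type.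
Hypothesis K_infinite : infinite_set [set: K].
Let embeds_nat := embeds_nat K_infinite.
Let embeds_square := embeds_square K_infinite.

Lemma embeds_prod (L L' : Type) : embeds L K -> embeds L' K -> embeds (L * L') K.
Proof.
move=> [f finj] [g ginj]; have [h hinj] := embeds_square.
by exists (fun p => h (f p.1, g p.2)) => -[a b] [c d] /hinj[/finj -> /ginj ->].
Qed.

Lemma embeds_bool : embeds bool K.
Proof.
by have [f finj] := embeds_nat; exists (f \o nat_of_bool) => -[] [] // /finj.
Qed.

(** A right fold of the pairing encodes the entries; the length is stored too, since the fold alone
    does not tell where the sequence ends. *)
Lemma embeds_seq : embeds (seq K) K.
Proof.
have [i iinj] := embeds_nat; have [h hinj] := embeds_square.
have [j jinj] := embeds_prod embeds_nat (embeds_refl K).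
exists (fun s => j (size s, foldr (fun a b => h (a, b)) (i 0) s)) => s t /jinj[].
elim: s t => [|a s IHs] [|b t] //= [st] /hinj[-> fst].
by rewrite (IHs t).
Qed.

(* [A] has cardinality at most 2^|K|; quantifying over surjections rather than
   injections makes images and unions immediate. *)
Definition covered (T : Type) (A : set T) :=
  exists g : set K -> T, A `<=` range g.

Lemma sub_covered (T : Type) (A B : set T) : A `<=` B -> covered B -> covered A.
Proof. by move=> AB [g Bg]; exists g => x /AB/Bg. Qed.

Lemma image_covered (T U : Type) (h : T -> U) (A : set T) :
  covered A -> covered (h @` A).
Proof. by move=> [g Ag]; exists (h \o g) => _ [x /Ag[c _ <-] <-]; exists c. Qed.

Lemma covered_subsingleton (T : Type) (t0 : T) (A : set T) :
  (forall x y, A x -> A y -> x = y) -> covered A.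
Proof.
move=> A1; have [[x Ax]|nA] := pselect (exists x, A x).
  by exists (fun=> x) => y Ay; exists set0 => //; exact: A1.
by exists (fun=> t0) => y Ay; case: nA; exists y.
Qed.

Lemma covered_inj (T L : Type) (t0 : T) (h : T -> set L) :
  embeds L K -> injective h -> covered [set: T].
Proof.
move=> [j jinj] hinj.
have /choice[g gP] (c : set K) : exists t, forall u, j @` (h u) = c -> u = t.
  have [[t <-]|nt] := pselect (exists t, j @` (h t) = c); last first.
    by exists t0 => u uc; case: nt; exists u.
  exists t => u ut; apply: hinj; apply/seteqP; split => x hx.
  - have : (j @` h t) (j x) by rewrite -ut; exists x.
    by move=> [y hy /jinj <-].
  - have : (j @` h u) (j x) by rewrite ut; exists x.
    by move=> [y hy /jinj <-].
by exists g => t _; exists (j @` h t) => //; rewrite -(gP _ t).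
Qed.

Lemma covered_embeds (T : Type) (t0 : T) : embeds T K -> covered [set: T].
Proof.
move=> TK; apply: (covered_inj t0 (h := fun t => [set t])) TK _ => t u tu.
by have : [set u] t by rewrite -tu.
Qed.

Lemma covered_card_le (T : Type) (t0 : T) (A : set T) : A #<= [set: K] -> covered A.
Proof.
have [i _] := embeds_nat.
move=> /(card_le_inj (i 0))[f _ finj].
apply: (@sub_covered _ _ (\bigcup_(k in [set: K]) [set a | A a /\ f a = k])).
  by move=> a Aa; exists (f a).
have /choice[g gP] k : exists a, forall b, A b -> f b = k -> b = a.
  have [[a [Aa ak]]|na] := pselect (exists a, A a /\ f a = k).
    by exists a => b Ab bk; apply: finj => //; rewrite ak bk.
  by exists t0 => b Ab bk; case: na; exists b.
apply: (@sub_covered _ _ (g @` [set: K])).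
  by move=> a [_ _ [Aa _]]; exists (f a) => //; rewrite -(gP (f a) a).
by apply: image_covered; apply: (covered_embeds (i 0)); exact: embeds_refl.
Qed.

Lemma covered_range (T : Type) (h : K -> T) : covered (range h).
Proof.
have [i _] := embeds_nat.
by apply/image_covered/(covered_embeds (i 0)); exact: embeds_refl.
Qed.

(** Currying: (2^|K|)^|L| = 2^(|L| |K|), and [L * K] embeds in [K]. *)
Lemma covered_fun (T L : Type) (A : set T) :
  embeds L K -> covered A -> covered [set f : L -> T | forall l, A (f l)].
Proof.
move=> LK [g Ag].
have cK : covered [set: L -> set K].
  pose h (F : L -> set K) := [set p : L * K | F p.1 p.2].
  apply: (@covered_inj _ _ (fun=> set0) h).
    by apply: embeds_prod => //; exact: embeds_refl.
  move=> F G FG; apply/funext => l; apply/funext => k.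
  exact: (congr1 (fun H : set (L * K) => H (l, k)) FG).
apply: sub_covered (image_covered (fun F l => g (F l)) cK) => f fA.
have /choice[F FP] l : exists c, g c = f l.
  by have [c _ <-] := Ag _ (fA l); exists c.
by exists F => //; apply/funext => l.
Qed.

(** Two subsets of [K], packed as a function on [bool], name a point of the union: one gives the
    index [i], the other the point within [F i]. *)
Lemma covered_bigcup (T I : Type) (J : set I) (F : I -> set T) (t0 : T) :
  covered J -> (forall i, J i -> covered (F i)) -> covered (\bigcup_(i in J) F i).
Proof.
move=> [e Je] FJ.
have /choice[g gP] i : exists g : set K -> T, J i -> F i `<=` range g.
  have [Ji|nJi] := pselect (J i); first by have [g Fg] := FJ _ Ji; exists g.
  by exists (fun=> t0).
have [b binj] := embeds_bool.
have cB : covered [set: bool -> set K].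
  by apply: sub_covered (covered_fun embeds_bool (A := setT) _) => //; exists id => c; exists c.
pose h (c : bool -> set K) := g (e (c true)) (c false).
apply: sub_covered (image_covered h cB).
move=> x [i Ji Fx]; have [c _ ci] := Je _ Ji.
have [d _ dx] := gP _ Ji _ Fx.
by exists (fun b => if b then c else d) => //; rewrite /h ci.
Qed.

Lemma covered_seq (T : Type) (A : set T) :
  covered A -> covered [set s : seq T | all (fun x => x \in A) s].
Proof.
move=> cA.
have [[a0 Aa0]|nA] := pselect (exists a, A a); last first.
  exists (fun=> [::]) => -[_|x s /= /andP[/set_mem Ax _]]; first by exists set0.
  by case: nA; exists x.
(* A sequence is an initial segment of a function on [nat]; the default [a0] keeps the values beyond
   its end in [A]. *)
apply: (@sub_covered _ _ (\bigcup_(n in [set: nat])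
    ((fun f => mkseq f n) @` [set f : nat -> T | forall l, A (f l)]))).
  move=> s sA; exists (size s) => //; exists (nth a0 s); last exact: mkseq_nth.
  elim: s sA => [_ l|x s IHs /= /andP[/set_mem Ax sA] [|l]] //=; first by rewrite nth_nil.
  exact: IHs.
apply: covered_bigcup => [||n _]; first exact: [::].
  exact: covered_embeds 0 embeds_nat.
by apply: image_covered; apply: covered_fun.
Qed.

Lemma covered_card (T : Type) : covered [set: T] -> [set: T] #<= [set: set K].
Proof.
move=> [g Tg]; apply: (card_le_rel (R := fun t c => g c = t)).
  by move=> t _; have [c _ <-] := Tg t I; exists c.
by move=> t t' c _ _ <-.
Qed.

(* Closing off under [K]-ary operations: well-founded [K]-branching terms
   replace a transfinite recursion of length |K|^+. *)
Inductive term :=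
| Leaf
| Node of set K & (K -> term).

(** A set of marked paths: the mark [true] tells that a [Node] sits at the end of the path, the mark
    [false] lists its label. *)
Fixpoint term_code (t : term) : set (seq K * (bool * K)) :=
  if t is Node c b then
    fun p => if p.1 is k :: l then term_code (b k) (l, p.2)
             else p.2.1 \/ c p.2.2
  else set0.

Lemma term_code_inj : injective term_code.
Proof.
have [i _] := embeds_nat.
elim=> [|c b IH] [|c' b'] // E.
- by have : term_code Leaf ([::], (true, i 0)) by rewrite E; left.
- by have : term_code Leaf ([::], (true, i 0)) by rewrite -E; left.
have Ek l (bo : bool) k : term_code (Node c b) (l, (bo, k)) = term_code (Node c' b') (l, (bo, k)).
  by rewrite E.
have -> : c = c'.
  apply/seteqP; split => k ck.
    by have [] : term_code (Node c' b') ([::], (false, k)) by rewrite -Ek; right.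
  by have [] : term_code (Node c b) ([::], (false, k)) by rewrite Ek; right.
congr Node; apply/funext => k; apply: IH; apply/funext => -[l [bo m]].
exact: Ek (k :: l) bo m.
Qed.

Lemma closing_off (T : Type) (t0 : T) (Phi : (K -> T) -> set T) :
  (forall f, covered (Phi f)) ->
  exists M : set T, [/\ covered M, M t0 &
    forall f, (forall k, M (f k)) -> Phi f `<=` M].
Proof.
move=> /choice[g gP].
(* At a node, the branches name the arguments of the operation, and the label selects a point in an
   enumeration covering its value. *)
pose ev := fix ev t := if t is Node c b then g (fun k => ev (b k)) c else t0.
exists (range ev); split; last 2 first.
- by exists Leaf.
- move=> f fM x /gP[c _ <-].
  have /choice[b bP] k : exists t, ev t = f k by have [t _] := fM k; exists t.
  by exists (Node c b) => //=; congr (g _ c); apply/funext.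
apply/image_covered/(covered_inj Leaf (h := term_code)); last exact: term_code_inj.
apply: embeds_prod; first exact: embeds_seq.
by apply: embeds_prod; [exact: embeds_bool|exact: embeds_refl].
Qed.

End covered.

(** * Neighbourhoods of points and their traces on the isolated points *)

Definition missed (I T : Type) (A : set T) (V : I -> set T) (s : seq I) : set T :=
  [set d | A d /\ all (fun i => d \notin V i) s].

Section space.
Variables (K : Type) (X : topologicalType).
Hypothesis K_infinite : infinite_set [set: K].
Let D : set X := isolated [set: X].

Lemma open_isolated_point (d : X) : D d -> open_nbhs d [set d].
Proof.
move=> [_ [V + Vd]]; rewrite setIT in Vd; subst V => Vd; split => //.
by rewrite openE => _ ->.
Qed.

(** Otherwise the missed sets form a wide filter base. A theta-adherent point [x] then yields an
    isolated point in the closure of [V x] but not in [V x], which is impossible since its singleton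
    is open. *)
Lemma finite_cover_mod_wide (S : set X) (V : X -> set X) :
    wH_closed K X -> S `<=` D -> (forall x, open_nbhs x (V x)) ->
  exists s : seq X, ~ ([set: K] #<= missed S V s).
Proof.
move=> X_wH SD VP; apply: contrapT => /forallNP Vwide.
pose F := range (fun s : seq X => missed S V s).
have [i _] := embeds_nat K_infinite.
have [||x Fx] := X_wH F.
- split; first by exists (missed S V [::]), [::].
  + move=> _ [s _ <-]; apply/set0P/eqP => s0.
    have := contrapT (Vwide s); rewrite s0 => /card_le0P K0.
    by have : [set: K] (i 0) by []; rewrite K0.
  + move=> _ _ [s _ <-] [t _ <-].
    exists (missed S V (s ++ t)); first by exists (s ++ t).
    by move=> d [Sd]; rewrite all_cat => /andP[ds dt]; split; split.
- move=> _ [s _ <-]; apply: (card_le_trans (contrapT (Vwide s))).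
  apply: subset_card_le => d dA U [oU Ud].
  by exists d; split => //; exact: subset_closure.
have FVx : F (missed S V [:: x]) by exists [:: x].
have [d [dV [Sd /andP[/negP dnV _]]]] := Fx _ FVx (V x) (VP x).
have [e [Ve de]] := dV _ (open_nbhs_nbhs (open_isolated_point (SD _ Sd))).
by apply: dnV; rewrite -de; exact: mem_set.
Qed.

Lemma local_base_family : character_le X K ->
  exists B : X -> K -> set X, forall x, (forall k, open_nbhs x (B x k)) /\
    forall U, nbhs x U -> exists k, B x k `<=` U.
Proof.
move=> X_char.
suff /choice[B BP] x : exists B : K -> set X, (forall k, open_nbhs x (B k)) /\
    forall U, nbhs x U -> exists k, B k `<=` U by exists B.
have [G [Go Gb] GK] := X_char x.
have [i _] := embeds_nat K_infinite.
have [h _ hinj] := card_le_inj (i 0) GK.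
have oT : open_nbhs x [set: X] by split => //; exact: openT.
(* Indices that name no member of the base get the whole space. *)
have /choice[B BP] k : exists U, open_nbhs x U /\ forall V, G V -> h V = k -> V = U.
  have [[U GU <-]|nU] := pselect (exists2 U, G U & h U = k).
    by exists U; split=> [|V GV]; [exact: Go|exact: hinj].
  by exists [set: X]; split => // V GV Vk; case: nU; exists V.
exists B; split=> [k|U]; first exact: (BP k).1.
rewrite nbhsE => -[V oV VU]; have [W GW WV] := Gb _ oV.
by exists (h W); rewrite -((BP (h W)).2 W)//; exact: subset_trans VU.
Qed.

(* A point [x] of the closure of [A] is determined by a choice of points of [A]
   in the pairwise intersections of its basic neighbourhoods. *)
Lemma covered_closure (x0 : X) (A : set X) :
  hausdorff_space X -> character_le X K -> covered K A -> covered K (closure A).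
Proof.
move=> X_T2 X_char cA; have [B BP] := local_base_family X_char.
pose lim (f : K * K -> X) := [set x | forall k, (forall l, B x k (f (k, l))) /\
  closure (range (fun l => f (k, l))) x].
apply: (@sub_covered _ _ _ (\bigcup_(f in [set f | forall kl, A (f kl)]) lim f)).
  move=> x Ax.
  have /choice[f fP] (kl : K * K) : exists y, A y /\ B x kl.1 y /\ B x kl.2 y.
    have [y [Ay [By1 By2]]] : A `&` (B x kl.1 `&` B x kl.2) !=set0.
      by apply: Ax; apply: filterI; exact: open_nbhs_nbhs ((BP x).1 _).
    by exists y.
  exists f => [kl|k]; first by case: (fP kl).
  split=> [l|U /(BP x).2[l lU]]; first by case: (fP (k, l)) => _ [].
  exists (f (k, l)); split; first by exists l.
  by apply: lU; case: (fP (k, l)) => _ [].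
apply: (covered_bigcup K_infinite x0) => [|f _].
  by apply: (covered_fun K_infinite) => //; exact: embeds_square.
(* For fixed [k], the points [f (k, l)] all lie in [B x k] and have [y] in their closure, so
   neighbourhoods of [x] and [y] always meet. *)
apply: (covered_subsingleton K x0) => x y xf yf; apply: X_T2 => U V.
move=> /(BP x).2[k kU] /((yf k).2)[_ [[l _ <-] Vl]].
by exists (f (k, l)); split => //; apply: kU; exact: (xf k).1.
Qed.

(* A finite subset of the closure of [S] lies in the closure of |K| many points
   of [S], so it is enough to close off under a |K|-ary operation. *)
Lemma reflecting_set (x0 : X) (B : X -> K -> set X) :
    hausdorff_space X -> character_le X K -> D x0 ->
    (forall x U, nbhs x U -> exists k, B x k `<=` U) ->
    (forall x k, open_nbhs x (B x k)) ->
  let W (s : seq (X * K)) := missed D (fun p => B p.1 p.2) s in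
  exists S : set X, [/\ S `<=` D, covered K S &
    forall s, all (fun p => p.1 \in closure S) s ->
      (covered K (W s) /\ W s `<=` S) \/ [set: K] #<= W s `&` S].
Proof.
move=> X_T2 X_char Dx0 Bb Bo W.
have [i _] := embeds_nat K_infinite.
(* A set [W s] of at most 2^|K| points is taken whole; a larger one contributes |K| of its
   points. *)
have /choice[Y YP] s : exists Y : set X, [/\ Y `<=` W s, covered K Y &
    (covered K (W s) /\ W s `<=` Y) \/ [set: K] #<= Y].
  have [cW|ncW] := pselect (covered K (W s)).
    by exists (W s); split=> [d||] //; left; split=> // d.
  have [WK|/(card_le_inj x0)[h hW hinj]] := card_le_total (W s) [set: K].
    by case: ncW; exact: (covered_card_le K_infinite x0).
  exists (range h); split=> [_ [k _ <-]||]; first exact: hW.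
    exact: covered_range.
  by right; apply: (embeds_card_le (f := h)) => [k|k l]; [exists k|exact: hinj].
pose Phi (f : K -> X) :=
  \bigcup_(s in [set s | all (fun p => p.1 \in closure (range f)) s]) Y s.
have [|M [cM Mx0 MP]] := closing_off K_infinite x0 (Phi := Phi).
  move=> f; apply: (covered_bigcup K_infinite x0) => [|s _]; last by case: (YP s).
  apply: sub_covered (covered_seq K_infinite (A := [set p : X * K | closure (range f) p.1]) _).
    by move=> s; apply: sub_all => p; rewrite !inE.
  apply: (@sub_covered _ _ _ (\bigcup_(x in closure (range f)) (pair x @` [set: K]))).
    by move=> [x k] xf; exists x => //; exists k.
  apply: (covered_bigcup K_infinite (x0, i 0)) => [|x _].
    apply: (covered_closure x0) => //.
    exact: covered_range.
  exact: covered_range.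
exists (M `&` D); split=> [|| s sS]; first by move=> x [].
  by apply: sub_covered cM => x [].
have YD : Y s `<=` D by case: (YP s) => YW _ _ x /YW[].
suff YM : Y s `<=` M.
  have [YW _ [[cW WY]|KY]] := YP s; [left|right].
    by split => // x /WY Yx; split; [exact: YM|exact: YD].
  by apply: (card_le_trans KY); apply: subset_card_le => x Yx; split;
    [exact: YW|split; [exact: YM|exact: YD]].
(* One point in each basic neighbourhood of [x] is enough to keep [x] in the closure. *)
have /choice[h hP] x : exists h : K -> X, (forall k, (M `&` D) (h k)) /\
    (closure (M `&` D) x -> closure (range h) x).
  have [Sx|nSx] := pselect (closure (M `&` D) x); last by exists (fun=> x0).
  have /choice[h hB] k : exists y, (M `&` D) y /\ B x k y.
    by have [y Sy] := Sx _ (open_nbhs_nbhs (Bo x k)); exists y.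
  exists h; split=> [k|_ U /Bb[k kU]]; first by case: (hB k).
  by exists (h k); split; [exists k|apply: kU; case: (hB k)].
have [j jinj] := embeds_prod K_infinite (embeds_nat K_infinite) (embeds_refl K).
have /choice[r rP] k : exists p, forall q, j q = k -> q = p.
  have [[p <-]|np] := pselect (exists p, j p = k); first by exists p => q /jinj.
  by exists (0, i 0) => q qk; case: np; exists q.
(* The ranges for the points of [s] are merged by coding [nat * K] in [K]; positions beyond the end
   use [x0], for which [h] also stays in [M] and [D]. *)
pose f k := h (nth (x0, i 0) s (r k).1).1 (r k).2.
apply: subset_trans (MP f _); last by move=> k; case: ((hP (nth (x0, i 0) s (r k).1).1).1 (r k).2).
apply: (@bigcup_sup _ _ s) => /=.
apply/(all_nthP (x0, i 0)) => n ns; apply/mem_set.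
have /(all_nthP (x0, i 0))/(_ n ns)/set_mem/(hP _).2 := sS.
apply: closureS => _ [k _ <-]; exists (j (n, k)) => //.
by rewrite /f -(rP (j (n, k)) (n, k)).
Qed.

End space.

Theorem theorem5p10 (K : Type) (X : topologicalType)
    (K_infinite : infinite_set [set: K])
    (X_wH_closed : wH_closed K X)
    (X_hausdorff : hausdorff_space X)
    (X_isolated_dense : dense (isolated [set: X]))
    (X_character : character_le X K) :
  [set: X] #<= [set: set K].
Proof.
have [[x _]|X0] := pselect (exists x : X, True); last first.
  by rewrite (_ : [set: X] = set0) ?card_ge0// -subset0 => x _; apply: X0; exists x.
have [x0 [_ Dx0]] : [set: X] `&` isolated [set: X] !=set0.
  by apply: X_isolated_dense; [exists x|exact: openT].
have [B /all_and2[Bo Bb]] := local_base_family K_infinite X_character.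
have [S [SD cS SP]] := reflecting_set K_infinite X_hausdorff X_character Dx0 Bb Bo.
have DS : isolated [set: X] `<=` S.
  move=> d Dd; apply: contrapT => nSd.
  have /choice[k kP] y : exists k, closure S y -> ~ B y k d.
    have [Sy|nSy] := pselect (closure S y); last first.
      by have [k _] := Bb y [set: X] filterT; exists k.
    have ody := open_isolated_point Dd.
    have [U [Uy nUd]] : exists U, nbhs y U /\ ~ U d.
      apply: contrapT => /forallNP nU.
      have yd : y <> d.
        move=> yd; move: Sy; rewrite yd => /(_ _ (open_nbhs_nbhs ody))[e [Se ed]].
        by apply: nSd; rewrite -ed.
      apply: yd; apply: X_hausdorff => U V Uy Vd.
      exists d; split; last exact: nbhs_singleton.
      by apply: contrapT => nUd; apply: (nU U).
    by have [k kU] := Bb _ _ Uy; exists k => _ /kU.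
  pose V y := if pselect (closure S y) then B y (k y) else ~` closure S.
  have [y|s] := finite_cover_mod_wide K_infinite X_wH_closed SD (V := V).
    rewrite /V; case: pselect => //= nSy; split => //.
    exact: (closed_openC (@closed_closure _ S)).
  apply.
  pose s' := [seq (y, k y) | y <- s & y \in closure S].
  have [|[_ WS]|KW] := SP s'.
  - by rewrite all_map all_filter; apply/allP => y _ /=; apply/implyP.
  (* The choice of [k] makes [s'] miss [d], which rules out this alternative. *)
  - case: nSd; apply: WS; split => //.
    rewrite all_map all_filter; apply/allP => y _ /=; apply/implyP => /set_mem Sy.
    by apply/negP => /set_mem; exact: kP.
  apply: (card_le_trans KW); apply: subset_card_le => e [[_ es'] Se]; split => //.
  move: es'; rewrite all_map all_filter => /allP es'; apply/allP => y /es' /=.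
  rewrite /V; case: pselect => //= [Sy|nSy _].
    by rewrite (mem_set Sy).
  by apply/negP => /set_mem; apply; exact: subset_closure.
apply: (covered_card); apply: sub_covered (covered_closure K_infinite x0 X_hausdorff X_character cS).
move=> y _ U Uy.
have [e [Ue De]] := X_isolated_dense U° (ex_intro _ y Uy) (@open_interior _ U).
by exists e; split; [exact: DS|exact: interior_subset].
Qed.
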